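(* Suppose that for every positive word $w\in F$ and all $r,s\in\mathbb{Q}$ one has $R(w,r-,s-)\in\mathbb{Q}$. Then for every $w\in F$ (not necessarily positive) and all $r,s\in\mathbb{Q}$ one has $R(w,r-,s-)\in\mathbb{Q}$.
   Context: $F$ is the free group on two generators $a,b$. A word in $F$ is positive if it contains only the letters $a$ and $b$, and no $a^{-1}$ or $b^{-1}$. $\mathrm{Homeo}^+(S^1)^\sim$ denotes the group of increasing homeomorphisms of $\mathbb{R}$ commuting with $x\mapsto x+1$, $R_\theta\in\mathrm{Homeo}^+(S^1)^\sim$ is the translation $x\mapsto x+\theta$, and $\mathrm{rot}^\sim(\varphi)=\lim_{n\to\infty}(\varphi^n(x)-x)/n\in\mathbb{R}$ is the real-valued Poincaré rotation number. For arbitrary $w\in F$ and $r,s\in\mathbb{R}$, $R(w,r-,s-)$ denotes the supremum of $\mathrm{rot}^\sim(\rho(w))$ over all homomorphisms $\rho:F\to\mathrm{Homeo}^+(S^1)^\sim$ for which $\rho(a)$ and $\rho(b)$ are conjugate to $R_r$ and $R_s$ respectively. *)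

(* Defs.v *)
From HB Require Import structures.
From mathcomp Require Import all_boot all_order all_algebra.
From mathcomp Require Import all_classical all_reals all_analysis.
From mathcomp Require Import ring lra.

Set Implicit Arguments.
Unset Strict Implicit.
Unset Printing Implicit Defensive.

Import Order.TTheory GRing.Theory Num.Theory.
Import numFieldNormedType.Exports.

Local Open Scope classical_set_scope.
Local Open Scope ring_scope.

(* A letter is a generator ([false] for a, [true] for b) together with the
   sign of its exponent ([true] for +1, [false] for -1). *)
Definition letter : Type := (bool * bool)%type.

Definition linv (x : letter) : letter := (x.1, ~~ x.2).

Definition reduced (w : seq letter) : bool :=
  sorted (fun x y => y != linv x) w.

(* The free group on two generators, as the group of reduced words. *)
Record freeF2 := FreeF2 { fword :> seq letter; fwordP : reduced fword }.

HB.instance Definition _ := [isSub for fword].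
HB.instance Definition _ := [Choice of freeF2 by <:].

(* Left multiplication of a reduced word by a letter, with cancellation. *)
Definition lact (x : letter) (w : seq letter) : seq letter :=
  if w is y :: w' then (if y == linv x then w' else x :: w) else [:: x].

Lemma linvK : involutive linv.
Proof. by case=> g e; rewrite /linv /= negbK. Qed.

Lemma reduced_lact x w : reduced w -> reduced (lact x w).
Proof.
case: w => [|y w] //= rw; case: ifP => [_|/negbT ne].
  exact: path_sorted rw.
by rewrite /= ne.
Qed.

Lemma reduced_foldr u w : reduced w -> reduced (foldr lact w u).
Proof. by move=> rw; elim: u => //= x u IH; apply: reduced_lact. Qed.

Lemma lactK x w : reduced w -> lact (linv x) (lact x w) = w.
Proof.
case: w => [|y w] /= rw; first by rewrite linvK eqxx.
case: ifP => [/eqP ey|_] /=; last by rewrite linvK eqxx.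
case: w rw => [|z w] /=; first by rewrite ey.
by rewrite ey linvK => /andP[/negbTE -> _].
Qed.

Lemma foldr_lact x u w : reduced w ->
  foldr lact w (lact x u) = lact x (foldr lact w u).
Proof.
move=> rw; case: u => [|y u] //=; case: ifP => [/eqP ->|//].
have := lactK (linv x) (reduced_foldr u rw).
by rewrite linvK => ->.
Qed.

Lemma foldr_lactA u v w : reduced w ->
  foldr lact w (foldr lact v u) = foldr lact (foldr lact w v) u.
Proof. by move=> rw; elim: u => //= x u IH; rewrite foldr_lact // IH. Qed.

Lemma foldr_lact0 w : reduced w -> foldr lact [::] w = w.
Proof.
elim: w => // x w IH rw /=; rewrite IH; last exact: path_sorted rw.
by case: w rw {IH} => [|y w] //= /andP[/negbTE ->].
Qed.

Lemma reduced_rev_inv w : reduced w -> reduced (rev (map linv w)).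
Proof.
rewrite /reduced rev_sorted sorted_map; apply: sub_sorted => x y /=.
by apply: contra => /eqP ->; rewrite linvK.
Qed.

Lemma foldr_rev_inv w v : reduced v ->
  foldr lact (foldr lact v w) (rev (map linv w)) = v.
Proof.
move=> rv; elim: w => //= x w IH.
by rewrite rev_cons -cats1 foldr_cat /= lactK ?reduced_foldr.
Qed.

Definition fone : freeF2 := @FreeF2 [::] isT.
Definition fmul (u v : freeF2) : freeF2 :=
  FreeF2 (reduced_foldr u (fwordP v)).
Definition finv (u : freeF2) : freeF2 := FreeF2 (reduced_rev_inv (fwordP u)).

Lemma fmulA : associative fmul.
Proof. by move=> u v w; apply/val_inj; rewrite /= foldr_lactA // fwordP. Qed.

Lemma fmul1g : left_id fone fmul.
Proof. by move=> u; apply/val_inj. Qed.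

Lemma fmulg1 : right_id fone fmul.
Proof. by move=> u; apply/val_inj; rewrite /= foldr_lact0 // fwordP. Qed.

Lemma fmulVg : left_inverse fone finv fmul.
Proof.
move=> u; apply/val_inj => /=.
by rewrite -{1}(foldr_lact0 (fwordP u)) foldr_rev_inv.
Qed.

Lemma fmulgV : right_inverse fone finv fmul.
Proof.
move=> u; have e : finv (finv u) = u.
  apply/val_inj; rewrite /= map_rev revK -map_comp.
  by rewrite -[RHS]map_id; apply: eq_map => x; apply: linvK.
by rewrite -{1}e fmulVg.
Qed.

HB.instance Definition _ := isGroup.Build freeF2 fmulA fmul1g fmulg1 fmulVg fmulgV.

Definition gen_a : freeF2 := @FreeF2 [:: (false, true)] isT.
Definition gen_b : freeF2 := @FreeF2 [:: (true, true)] isT.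

(* No letter a^-1 or b^-1 in the reduced word. *)
Definition positive (w : freeF2) : bool := all (fun x : letter => x.2) (fword w).

Section HomeoLift.
Variable R : realType.

Record homeoS1 := HomeoS1 {
  hfun :> R -> R;
  hinv : R -> R;
  hfunK : cancel hfun hinv;
  hinvK : cancel hinv hfun;
  hfun_continuous : continuous hfun;
  hinv_continuous : continuous hinv;
  hfun_increasing : {homo hfun : x y / x < y};
  hfunD1 : forall x, hfun (x + 1) = hfun x + 1
}.

Lemma homeoS1_eq (f g : homeoS1) : hfun f =1 hfun g -> f = g.
Proof.
case: f g => [f f' fK f'K cf cf' mf f1] [g g' gK g'K cg cg' mg g1] /= /funext fg.
subst g; have fg' : f' = g' by apply/funext => x; rewrite -{1}(g'K x) fK.
by subst g'; f_equal; exact: Prop_irrelevance.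
Qed.

HB.instance Definition _ := gen_eqMixin homeoS1.
HB.instance Definition _ := gen_choiceMixin homeoS1.

Lemma hinv_increasing (f : homeoS1) : {homo hinv f : x y / x < y}.
Proof.
move=> x y xy; rewrite ltNge; apply/negP => le.
have : hfun f (hinv f y) <= hfun f (hinv f x).
  exact: (ltW_homo (@hfun_increasing f)).
by rewrite !hinvK leNgt xy.
Qed.

Lemma hinvD1 (f : homeoS1) x : hinv f (x + 1) = hinv f x + 1.
Proof. by apply: (can_inj (hfunK f)); rewrite hfunD1 !hinvK. Qed.

Definition hone : homeoS1 :=
  @HomeoS1 id id (fun _ => erefl) (fun _ => erefl) (fun _ => cvg_id)
    (fun _ => cvg_id) (fun _ _ => id) (fun _ => erefl).

Definition hinvg (f : homeoS1) : homeoS1 :=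
  HomeoS1 (@hinvK f) (@hfunK f) (@hinv_continuous f) (@hfun_continuous f)
    (@hinv_increasing f) (@hinvD1 f).

Definition hmul (f g : homeoS1) : homeoS1.
Proof.
apply: (@HomeoS1 (hfun f \o hfun g) (hinv g \o hinv f)).
- exact: can_comp (@hfunK f) (@hfunK g).
- exact: can_comp (@hinvK g) (@hinvK f).
- by move=> x; apply: continuous_comp; exact: hfun_continuous.
- by move=> x; apply: continuous_comp; exact: hinv_continuous.
- by move=> x y xy /=; do 2 apply: hfun_increasing.
- by move=> x /=; rewrite !hfunD1.
Defined.

Lemma hmulA : associative hmul.
Proof. by move=> f g h; apply: homeoS1_eq. Qed.

Lemma hmul1g : left_id hone hmul.
Proof. by move=> f; apply: homeoS1_eq. Qed.

Lemma hmulg1 : right_id hone hmul.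
Proof. by move=> f; apply: homeoS1_eq. Qed.

Lemma hmulVg : left_inverse hone hinvg hmul.
Proof. by move=> f; apply: homeoS1_eq => x; exact: hfunK. Qed.

Lemma hmulgV : right_inverse hone hinvg hmul.
Proof. by move=> f; apply: homeoS1_eq => x; exact: hinvK. Qed.

HB.instance Definition _ :=
  isGroup.Build homeoS1 hmulA hmul1g hmulg1 hmulVg hmulgV.

Definition translation (t : R) : homeoS1.
Proof.
apply: (@HomeoS1 (fun x => x + t) (fun x => x - t)).
- exact: addrK.
- exact: subrK.
- by move=> x; apply: cvgD; [exact: cvg_id|exact: cvg_cst].
- by move=> x; apply: cvgB; [exact: cvg_id|exact: cvg_cst].
- by move=> x y; rewrite ltrD2r.
- by move=> x; rewrite addrAC.
Defined.

(* See [rotnum_cvg]: the limit exists and the base point 0 is immaterial. *)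
Definition rotnum (f : homeoS1) : R :=
  lim ((iter n (hfun f) 0 - 0) / n%:R @[n --> \oo]).

(* Here [y ^ h] is h^-1 * (y * h). *)
Definition conjugate (G : groupType) (x y : G) : Prop :=
  exists h : G, x = (y ^ h)%g.

Definition rotnum_values (w : freeF2) (r s : R) : set R :=
  [set t | exists rho : UMagmaMorphism.type freeF2 homeoS1,
    [/\ conjugate (rho gen_a) (translation r),
        conjugate (rho gen_b) (translation s) & t = rotnum (rho w)]].

(* R(w, r-, s-); the set is nonempty and bounded above, see
   [rotnum_values_has_sup]. *)
Definition Rmax (w : freeF2) (r s : R) : R := sup (rotnum_values w r s).

End HomeoLift.

Section RotCvg.
Variable R : realType.
Implicit Types (f g : homeoS1 R) (x y : R).

Lemma hfunDn f x n : f (x + n%:R) = f x + n%:R.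
Proof.
elim: n => [|n IH]; first by rewrite !addr0.
by rewrite -natr1 !addrA hfunD1 IH.
Qed.

Lemma hfunDz f x (k : int) : f (x + k%:~R) = f x + k%:~R.
Proof.
case: k => n; first exact: hfunDn.
rewrite NegzE mulrNz.
have := hfunDn f (x - n.+1%:R) n.+1.
by rewrite subrK => ->; rewrite addrK.
Qed.

Lemma disp_le1 f x y : `|(f x - x) - (f y - y)| <= 1.
Proof.
set k := Num.floor (x - y).
have /andP[k1 k2] : (k%:~R <= x - y < (k + 1)%:~R).
  by rewrite floor_le ?floorD1_gt ?num_real.
have h1 : f (y + k%:~R) <= f x.
  by apply: (ltW_homo (@hfun_increasing _ f)); lra.
have h2 : f x <= f (y + (k + 1)%:~R).
  by apply: (ltW_homo (@hfun_increasing _ f)); lra.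
move: h1 h2 k2; rewrite !hfunDz intrD => h1 h2 k2.
by rewrite ler_norml; apply/andP; split; lra.
Qed.

Lemma hfun_expg f n x : (f ^+ n)%g x = iter n f x.
Proof. by elim: n x => // n IH x; rewrite expgS iterS -IH. Qed.

Definition disp f n x : R := iter n f x - x.

Lemma dispM f m n x : `|disp f (m * n) x - m%:R * disp f n x| <= m%:R.
Proof.
elim: m => [|m IH]; first by rewrite mul0n mul0r /disp /= !subrr normr0.
have h : `|disp f n (iter (m * n) f x) - disp f n x| <= 1.
  by have := disp_le1 (f ^+ n)%g (iter (m * n) f x) x; rewrite !hfun_expg.
rewrite mulSn /disp iterD -natr1.
move: IH h; rewrite /disp !ler_norml => /andP[? ?] /andP[? ?].
by apply/andP; split; lra.
Qed.

Lemma disp_cauchy f x m n : (0 < m)%N -> (0 < n)%N ->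
  `|disp f m x / m%:R - disp f n x / n%:R| <= m%:R^-1 + n%:R^-1.
Proof.
move=> m0 n0.
have mr : 0 < m%:R :> R by rewrite ltr0n.
have nr : 0 < n%:R :> R by rewrite ltr0n.
have h1 := dispM f m n x; have h2 := dispM f n m x.
rewrite mulnC in h2.
have -> : disp f m x / m%:R - disp f n x / n%:R =
  (n%:R * disp f m x - m%:R * disp f n x) / (m%:R * n%:R).
  by field; rewrite !gt_eqF.
have -> : m%:R^-1 + n%:R^-1 = (m%:R + n%:R) / (m%:R * n%:R) :> R.
  by field; rewrite !gt_eqF.
rewrite normrM [X in _ * X]gtr0_norm ?invr_gt0 ?mulr_gt0 //.
apply: ler_wpM2r; first by rewrite invr_ge0 mulr_ge0 ?ltW.
move: h1 h2; rewrite !ler_norml => /andP[? ?] /andP[? ?].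
by apply/andP; split; lra.
Qed.

Lemma invn_lt (e : R) : 0 < e -> \forall n \near \oo, (0 < n)%N /\ n%:R^-1 < e.
Proof.
move=> e0; have := near_infty_natSinv_lt (PosNum e0) => h.
case: h => N _ h; exists N.+1 => // -[|n] //= Nn; split=> //; exact: h.
Qed.

Lemma disp_cvg f : cvgn (fun n => disp f n 0 / n%:R).
Proof.
apply/cauchy_cvgP/cauchy_exP => e e0.
have e2 : 0 < e / 2 by lra.
have h := invn_lt e2.
have [N _ hN] := h; have [N0 N1] := hN N (leqnn N).
exists (disp f N 0 / N%:R).
suff : \forall n \near \oo, ball (disp f N 0 / N%:R) e (disp f n 0 / n%:R) by [].
near=> n.
have [n0 n1] : (0 < n)%N /\ n%:R^-1 < e / 2 by near: n.
rewrite /ball /=.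
apply: (le_lt_trans (@disp_cauchy f 0 N n _ _)) => //; lra.
Unshelve. all: by end_near.
Qed.

(* The limit defining [rotnum] exists and does not depend on the base point. *)
Lemma rotnum_cvg f x : (iter n (hfun f) x - x) / n%:R @[n --> \oo] --> rotnum f.
Proof.
apply/cvgrPdist_lt => e e0.
have e2 : 0 < e / 2 by lra.
have /cvgrPdist_lt /(_ _ e2) h0 := @disp_cvg f.
have h := invn_lt e2.
near=> n.
have [n0 n1] : (0 < n)%N /\ n%:R^-1 < e / 2 by near: n.
have h1 : `|rotnum f - disp f n 0 / n%:R| < e / 2 by near: n.
have h2 : `|disp f n 0 / n%:R - disp f n x / n%:R| <= n%:R^-1.
  rewrite -mulrBl normrM [X in _ * X]gtr0_norm ?invr_gt0 ?ltr0n //.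
  rewrite ler_piMl ?invr_ge0 //.
  by have := disp_le1 (f ^+ n)%g 0 x; rewrite !hfun_expg.
rewrite -/(disp f n x).
have := ler_distD (disp f n 0 / n%:R) (rotnum f) (disp f n x / n%:R).
by lra.
Unshelve. all: by end_near.
Qed.

Lemma rotnum_bound f (B : R) : (forall x, `|f x - x| <= B) -> `|rotnum f| <= B.
Proof.
move=> h.
have hd n : `|disp f n 0| <= n%:R * B.
  elim: n => [|n IH]; first by rewrite mul0r /disp subrr normr0.
  have := h (iter n f 0); rewrite /disp iterS -natr1 mulrDl mul1r.
  move: IH; rewrite /disp => ? ?.
  have := ler_distD (iter n f 0) (f (iter n f 0)) 0; lra.
apply/ler_addgt0Pr => e e0.
have /cvgrPdist_lt /(_ _ e0) h0 := @disp_cvg f.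
near \oo => n.
have n0 : (0 < n)%N by near: n; exists 1%N.
have h1 : `|rotnum f - disp f n 0 / n%:R| < e by near: n.
have h2 : `|disp f n 0 / n%:R| <= B.
  rewrite normrM [X in _ * X]gtr0_norm ?invr_gt0 ?ltr0n //.
  by rewrite ler_pdivrMr ?ltr0n // mulrC.
have := ler_distD (disp f n 0 / n%:R) (rotnum f) 0; rewrite !subr0.
by lra.
Unshelve. all: by end_near.
Qed.

Lemma translation_conj_disp g (r : R) : conjugate g (translation r) ->
  forall x, `|g x - x| <= `|r| + 1.
Proof.
case=> h -> x; set y := hfun h x.
have -> : (translation r ^ h)%g x = hinv h (y + r) by [].
have hx : x = hinv h y by rewrite /y hfunK.
have := disp_le1 h (hinv h (y + r)) x; rewrite hinvK -/y.
have := ler_norm r; have := ler_norm (- r); rewrite normrN.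
rewrite !ler_norml => ? ? /andP[? ?].
by apply/andP; split; lra.
Qed.

Lemma inv_disp f (B : R) :
  (forall x, `|f x - x| <= B) -> forall x, `|(f^-1)%g x - x| <= B.
Proof.
move=> h x; have := h (hinv f x); rewrite hinvK distrC.
by [].
Qed.

Lemma rho_disp (rho : UMagmaMorphism.type freeF2 (homeoS1 R)) (B : R) :
  (forall x, `|rho gen_a x - x| <= B) -> (forall x, `|rho gen_b x - x| <= B) ->
  forall (w : freeF2) x, `|rho w x - x| <= (size w)%:R * B.
Proof.
move=> ha hb [w rw] x.
pose l1 (l : letter) : freeF2 := @FreeF2 [:: l] isT.
have hl (l : letter) y : `|rho (l1 l) y - y| <= B.
  case: l => [[] []]; first exact: hb.
  - have -> : l1 (true, false) = (gen_b^-1)%g by exact/val_inj.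
    by rewrite gmulfV; apply: inv_disp.
  - exact: ha.
  have -> : l1 (false, false) = (gen_a^-1)%g by exact/val_inj.
  by rewrite gmulfV; apply: inv_disp.
elim: w rw => [|l w IH] rw /=.
  have -> : FreeF2 rw = 1%g by exact/val_inj.
  by rewrite gmulf1 mul0r subrr normr0.
have rw' : reduced w by exact: path_sorted rw.
have -> : FreeF2 rw = (l1 l * FreeF2 rw')%g.
  apply/val_inj => /=; case: w rw {IH rw'} => [|y w] //= /andP[/negbTE ne _].
  by rewrite ne.
rewrite gmulfM -natr1 mulrDl mul1r.
have h1 := hl l (rho (FreeF2 rw') x); have h2 := IH rw'.
have := ler_distD (rho (FreeF2 rw') x) ((rho (l1 l) * rho (FreeF2 rw'))%g x) x.
rewrite /= in h2.
set A := `|_ - rho (FreeF2 rw') x|; have hA : A <= B by exact: h1.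
by lra.
Qed.

End RotCvg.

(* The universal property of the free group. *)
Lemma freeF2_lift (G : groupType) (x y : G) :
  exists rho : UMagmaMorphism.type freeF2 G, rho gen_a = x /\ rho gen_b = y.
Proof.
pose L (l : letter) : G :=
  let g := if l.1 then y else x in if l.2 then g else (g^-1)%g.
have LV l : L (linv l) = ((L l)^-1)%g.
  by case: l => [[] []]; rewrite /L /= ?invgK.
pose P (w : seq letter) := foldr (fun l acc => (L l * acc)%g) 1%g w.
have PL l w : P (lact l w) = (L l * P w)%g.
  case: w => [|z w] //=; case: ifP => [/eqP ->|//].
  by rewrite LV mulVKg.
pose f (w : freeF2) := P w.
have fM : {morph f : u v / (u * v)%g}.
  move=> u v; rewrite /f /=; elim: (fword u) => [|l w IH] /=.
    by rewrite mul1g.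
  by rewrite PL IH mulgA.
have f_morph : monoid.monoid_morphism f by split.
pose M := isUMagmaMorphism.Build freeF2 G f f_morph.
pose rho : UMagmaMorphism.type freeF2 G := HB.pack f M.
by exists rho; rewrite /= /f /= /L /= !mulg1.
Qed.

Lemma rotnum_values_has_sup (R : realType) w (r s : R) : has_sup (rotnum_values w r s).
Proof.
split.
  have [rho [ra rb]] := freeF2_lift (translation r) (translation s).
  exists (rotnum (rho w)), rho; split=> //.
    by exists 1%g; rewrite conjg1.
  by exists 1%g; rewrite conjg1.
exists ((size w)%:R * (`|r| + `|s| + 1)) => _ [rho [ca cb ->]].
apply: (le_trans (ler_norm _)); apply: rotnum_bound; apply: rho_disp => x.
  by have /= := translation_conj_disp ca x; have := normr_ge0 s; lra.
by have /= := translation_conj_disp cb x; have := normr_ge0 r; lra.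
Qed.

(* Main.v *)
Require Import Defs.
From HB Require Import structures.
From mathcomp Require Import all_boot all_order all_algebra.
From mathcomp Require Import all_classical all_reals all_analysis.

(** A conjugate [g] of the translation by [p/q] satisfies [g^q = R_p], and
    [R_p] is central because [p] is an integer; hence [g^-1 = R_{-p} g^(q-1)].
    Replacing each inverse letter of a word by the corresponding power of the
    generator gives a positive word whose image differs from that of the
    original one by a fixed integer translation, for all admissible
    homomorphisms at once. The two sets of rotation numbers, and thus their
    suprema, differ by an integer. *)

Set Implicit Arguments.
Unset Strict Implicit.
Unset Printing Implicit Defensive.

Import Order.TTheory GRing.Theory Num.Theory.
Import numFieldNormedType.Exports.

Section IntegerTranslations.
Local Open Scope classical_set_scope.
Local Open Scope ring_scope.
Variable R : realType.
Implicit Types (f g : homeoS1 R) (r s t : R) (k : int).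

Lemma rational_mulrn r : rational r ->
  exists n k, r *+ n.+1 = k%:~R.
Proof.
move=> /rationalP [p [[|n] ->]].
  (* A zero denominator stands for r = 0, since division by zero gives 0. *)
  by exists 0%N, 0; rewrite invr0 mulr0 mul0rn.
by exists n, p; rewrite -[LHS]mulr_natr divfK // pnatr_eq0.
Qed.

Lemma rationalDz r k : rational r -> rational (k%:~R + r).
Proof.
by move=> [q _ <-]; exists (k%:~R + q); rewrite // rmorphD /= ratr_int.
Qed.

Lemma translation0 : translation 0 = 1%g :> homeoS1 R.
Proof. by apply: homeoS1_eq => x /=; rewrite addr0. Qed.

Lemma translationX t n : (translation t ^+ n)%g = translation (t *+ n).
Proof.
apply: homeoS1_eq => x; rewrite hfun_expg /=.
elim: n => [|n IH]; first by rewrite mulr0n addr0.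
by rewrite iterS IH /= -addrA -mulrSr.
Qed.

Lemma translationM s t : (translation s * translation t)%g = translation (s + t).
Proof. by apply: homeoS1_eq => x /=; rewrite -addrA [t + s]addrC. Qed.

Lemma translationV t : ((translation t)^-1)%g = translation (- t).
Proof. by apply: homeoS1_eq. Qed.

Lemma commute_translation_int f k : commute f (translation k%:~R).
Proof. by apply: homeoS1_eq => x /=; rewrite hfunDz. Qed.

Lemma conj_translationV f r n k :
  conjugate f (translation r) -> r *+ n.+1 = k%:~R ->
  (f^-1 = translation (- k)%:~R * f ^+ n)%g.
Proof.
move=> [h fE] rk.
(* This power is h^-1 R_k h, and R_k is central. *)
have fX : (f ^+ n.+1 = translation k%:~R)%g.
  by rewrite fE -conjXg translationX rk /conjg -commute_translation_int mulKg.
by rewrite rmorphN /= -translationV -fX expgSr invgM mulgVK.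
Qed.

(** By centrality (R_k f)^n = R_{nk} f^n, so each average displacement with n > 0 moves by exactly
    k. *)
Lemma rotnum_translationM f k :
  rotnum (translation k%:~R * f)%g = k%:~R + rotnum f.
Proof.
apply: cvg_lim => //.
suff : (iter n (translation k%:~R * f)%g 0 - 0) / n%:R @[n --> \oo]
    --> k%:~R + rotnum f by [].
have h : (k%:~R : R) + (iter n f 0 - 0) / n%:R @[n --> \oo]
    --> k%:~R + rotnum f.
  by apply: cvgD; [exact: cvg_cst|exact: rotnum_cvg].
(* The two sequences may differ at n = 0, where the quotients take the default value 0. *)
apply: cvg_trans h; apply: near_eq_cvg; near=> n.
have n0 : (n%:R : R) != 0 by rewrite pnatr_eq0 -lt0n; near: n; exists 1%N.
rewrite -!hfun_expg expgMn; last exact/esym/commute_translation_int.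
rewrite translationX /= !subr0 mulrDl addrC -(mulr_natr k%:~R n) mulfK.
Unshelve. all: by end_near.
Qed.

(** The translate is the Minkowski sum of {t} and A, and suprema add over such sums. *)
Lemma sup_addl (A : set R) t : has_sup A -> sup [set t + x | x in A] = t + sup A.
Proof.
move=> supA; rewrite -[t in RHS](@sup1 R) -sup_sumE; [|exact: has_sup1|exact: supA].
by congr sup; apply/seteqP; split=> x /= [y];
  [exists t => //; exists y|move=> -> [z Az <-]; exists z].
Qed.

End IntegerTranslations.

Section PositiveWords.
Local Open Scope group_scope.

(** [lact] either prepends its letter or deletes the head, so it never creates a letter of negative
    exponent. *)
Lemma positiveM (u v : freeF2) : positive u -> positive v -> positive (u * v).
Proof.
rewrite /positive /=; elim: (fword u) => //= x w IH /andP[x2 wpos] vpos.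
have := IH wpos vpos; case: (foldr lact v w) => [|y z] /= => [_|/andP[y2 zpos]].
  by rewrite x2.
by case: eqP => [_|_] //=; rewrite x2 y2.
Qed.

Lemma positiveX (u : freeF2) n : positive u -> positive (u ^+ n).
Proof. by move=> upos; elim: n => // n IH; rewrite expgS positiveM. Qed.

Definition fletter (x : letter) : freeF2 := @FreeF2 [:: x] isT.

(** Phrased with the group product instead of list cons, so that homomorphisms apply directly. *)
Lemma fword_ind (P : freeF2 -> Prop) :
  P 1 -> (forall x w, P w -> P (fletter x * w)) -> forall w, P w.
Proof.
move=> P1 PM [w rw]; elim: w rw => [|x w IH] rw.
  by have -> : FreeF2 rw = 1 by exact/val_inj.
have rw' : reduced w by exact: path_sorted rw.
have -> : FreeF2 rw = fletter x * FreeF2 rw'; last exact: PM.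
(* As the word is reduced, [x] does not cancel against its successor. *)
by apply/val_inj => /=; case: w rw {IH rw'} => [|y w] //= /andP[/negbTE ->].
Qed.

Lemma fletterE (x : letter) :
  fletter x = let g := if x.1 then gen_b else gen_a in if x.2 then g else g^-1.
Proof. by case: x => -[] []; apply/val_inj. Qed.

End PositiveWords.

Section PositiveReduction.
Local Open Scope classical_set_scope.
Local Open Scope ring_scope.
Variables (R : realType) (r s : R).
Hypotheses (r_rat : rational r) (s_rat : rational s).

Let admissible (rho : UMagmaMorphism.type freeF2 (homeoS1 R)) :=
  conjugate (rho gen_a) (translation r) /\ conjugate (rho gen_b) (translation s).

(** The integer is fixed before [rho], so that one shift serves the whole set of rotation
    numbers. *)
Let eq_mod_int (u v : freeF2) (k : int) := forall rho, admissible rho ->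
  (rho u = translation k%:~R * rho v)%g.

Lemma letter_positive (x : letter) :
  exists v k, positive v /\ eq_mod_int (fletter x) v k.
Proof.
have [n [k rk]] := rational_mulrn r_rat; have [m [l sl]] := rational_mulrn s_rat.
rewrite fletterE; case: x => [[] []] /=.
- by exists gen_b, 0; split=> // rho _; rewrite translation0 mul1g.
- exists (gen_b ^+ m)%g, (- l); split; first exact: positiveX.
  by move=> rho [_ cb]; rewrite gmulfV gmulfXn (conj_translationV cb sl).
- by exists gen_a, 0; split=> // rho _; rewrite translation0 mul1g.
- exists (gen_a ^+ n)%g, (- k); split; first exact: positiveX.
  by move=> rho [ca _]; rewrite gmulfV gmulfXn (conj_translationV ca rk).
Qed.

Lemma word_positive (w : freeF2) :
  exists v k, positive v /\ eq_mod_int w v k.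
Proof.
elim/fword_ind: w => [|x w [v [k [vpos wv]]]].
  exists 1%g, 0; split=> // rho _.
  by rewrite gmulf1 mulg1 translation0.
have [u [l [upos xu]]] := letter_positive x.
exists (u * v)%g, (l + k); split; first exact: positiveM.
move=> rho adm; rewrite !gmulfM xu // wv // rmorphD /= -translationM.
(* The inner translation R_k moves left past [rho u] by centrality. *)
by rewrite -!mulgA; congr (_ * _)%g; rewrite !mulgA commute_translation_int.
Qed.

Lemma Rmax_positive (w : freeF2) :
  exists (v : freeF2) (k : int), positive v /\ Rmax w r s = k%:~R + Rmax v r s.
Proof.
have [v [k [vpos wv]]] := word_positive w; exists v, k; split=> //.
rewrite /Rmax -sup_addl; last exact: rotnum_values_has_sup.
(* Admissibility does not involve the word, so the same [rho] serves in both inclusions. *)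
congr sup; apply/seteqP; split=> t /=.
  move=> [rho [ca cb ->]]; exists (rotnum (rho v)); first by exists rho.
  by rewrite wv // rotnum_translationM.
move=> [_ [rho [ca cb ->]] <-]; exists rho; split=> //.
by rewrite wv // rotnum_translationM.
Qed.

End PositiveReduction.

Theorem proposition4p7 (R : realType) :
  (forall w : freeF2, positive w ->
     forall r s : R, rational r -> rational s -> rational (Rmax w r s)) ->
  forall w : freeF2,
     forall r s : R, rational r -> rational s -> rational (Rmax w r s).
Proof.
move=> Rmax_rational w r s r_rat s_rat.
have [v [k [vpos ->]]] := Rmax_positive r_rat s_rat w.
exact/rationalDz/Rmax_rational.
Qed.
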